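(* Let $p$ be a prime, let $P$ be a Heisenberg $\mathbb{F}_p$-group, and let $\mathsf{V}=P/Z(P)$. Let $\psi\colon Z(P)\to\mathbb{C}^\times$ be a nontrivial character, let $R\in\{\mathbb{R},\mathbb{C},\mathbb{H}\}$ be the Frobenius–Schur type of the Heisenberg representation of $P$ corresponding to $\psi$, and let $A$ be a subgroup of $\operatorname{Aut}_Z(P)$. Suppose there is a Sylow $p$-subgroup $A_p$ of $A$, an isotropic subspace $\mathsf{V}^+$ of $\mathsf{V}$, and a splitting $0\times\mathsf{V}^+$ of $\mathsf{V}^+$ in $P$ such that $$A_p\subseteq\mathcal{P}(0\times\mathsf{V}^+).$$ Then the Heisenberg $R$-representation of $P$ extends to an $R$-representation of $A\ltimes P$.
   Context: A Heisenberg $\mathbb{F}_p$-group is a finite group $P$ whose center $Z(P)$ has order $p$, for which $P/Z(P)$ is abelian of exponent at most $p$, and which, if $p\neq2$, itself has exponent at most $p$. Identify $Z(P)$ with $\mathbb{F}_p$. The $\mathbb{F}_p$-vector space $\mathsf{V}=P/Z(P)$ carries the symplectic form $\omega_P(xZ(P),yZ(P))=[x,y]=xyx^{-1}y^{-1}$ and, if $p=2$, the nondegenerate quadratic form $Q_P(xZ(P))=x^2$, whose associated bilinear form is $\omega_P$. A subspace is isotropic if $\omega_P$ (for $p\ne2$), respectively $Q_P$ (for $p=2$), vanishes identically on it. A partial polarization is a decomposition $\mathsf{V}=\mathsf{V}^+\oplus\mathsf{V}_0\oplus\mathsf{V}^-$ with $\mathsf{V}^\pm$ isotropic, $\mathsf{V}_0$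 orthogonal to $\mathsf{V}^+\oplus\mathsf{V}^-$ and the form restricted to $\mathsf{V}_0$ nondegenerate. A splitting of a subspace $\mathsf{W}\subseteq\mathsf{V}$ in $P$ is a subgroup $0\times\mathsf{W}$ of $P$ that the projection $P\to\mathsf{V}$ maps isomorphically onto $\mathsf{W}$. $\operatorname{Aut}_Z(P)$ is the group of automorphisms of $P$ acting trivially on $Z(P)$. Given an isotropic subspace $\mathsf{V}^+$, part of a partial polarization $\mathsf{V}=\mathsf{V}^+\oplus\mathsf{V}_0\oplus\mathsf{V}^-$, and a splitting $0\times\mathsf{V}^+$, let $P_0$ be the preimage of $\mathsf{V}_0$ in $P$ and let $\mathsf{V}^+\times P_0$ denote the internal direct product of $0\times\mathsf{V}^+$ and $P_0$ in $P$, i.e. the preimage in $P$ of $\mathsf{V}^+\oplus\mathsf{V}_0$, which is the $\omega_P$-orthogonal complement of $\mathsf{V}^+$. Then $\mathcal{P}(0\times\mathsf{V}^+)$ is the subgroup of $\operatorname{Aut}_Z(P)$ consisting of the $g$ with $g(0\times\mathsf{V}^+)=0\times\mathsf{V}^+$ and $g(x)x^{-1}\in0\times\mathsf{V}^+$ for all $x\in\mathsf{V}^+\times P_0$. The Heisenberg representation corresponding to $\psi$ is the unique (up to isomorphism) irreducible complex representation of $P$ whose restriction to $Z(P)$ is $\psi$-isotypic. An irreducible complex representation of a finite group has Frobenius–Schur type $\mathbb{C}$ if it is not self-dual, $\mathbb{R}$ if it is self-dual with symmetric invariant form (equivalently, definable over $\mathbb{R}$), and $\mathbb{H}$ if it is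 self-dual with alternating invariant form (equivalently, it carries an invariant right $\mathbb{H}$-module structure). For $R\in\{\mathbb{R},\mathbb{C},\mathbb{H}\}$, an $R$-representation is an $R$-linear action on a right $R$-module $W$; its associated complex representation is $W$ if $R=\mathbb{C}$, $\mathbb{C}\otimes_{\mathbb{R}}W$ if $R=\mathbb{R}$, and $W$ regarded as a complex vector space via an $\mathbb{R}$-algebra embedding $\mathbb{C}\hookrightarrow\mathbb{H}$ if $R=\mathbb{H}$. The Heisenberg $R$-representation is the irreducible $R$-representation of $P$ whose associated complex representation is the Heisenberg representation. *)

(* Defs.v *)
From HB Require Import structures.
From mathcomp Require Import all_boot all_order all_algebra all_fingroup.
From mathcomp Require Import all_solvable all_field all_character.
From mathcomp Require Import complex ring reals.

Set Implicit Arguments.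
Unset Strict Implicit.
Unset Printing Implicit Defensive.

Import GroupScope GRing.Theory.
Local Open Scope ring_scope.
Local Open Scope complex_scope.

(* Hamilton's quaternions [Quat a b c d = a + b i + c j + d k] over F.        *)
Record quat (F : Type) := Quat { q1 : F; qi : F; qj : F; qk : F }.

Section QuatChoice.
Variable F : choiceType.
Definition quat_tuple (x : quat F) := (q1 x, qi x, qj x, qk x).
Definition tuple_quat (t : F * F * F * F) :=
  let: (a, b, c, d) := t in Quat a b c d.
Lemma quat_tupleK : cancel quat_tuple tuple_quat.
Proof. by case. Qed.
HB.instance Definition _ := Choice.copy (quat F) (can_type quat_tupleK).
End QuatChoice.

Section QuatRing.
Variable F : comNzRingType.
Implicit Types x y z : quat F.

Definition quat0 : quat F := Quat 0 0 0 0.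
Definition quat_one : quat F := Quat 1 0 0 0.
Definition quat_opp x := Quat (- q1 x) (- qi x) (- qj x) (- qk x).
Definition quat_add x y :=
  Quat (q1 x + q1 y) (qi x + qi y) (qj x + qj y) (qk x + qk y).
Definition quat_mul x y := Quat
  (q1 x * q1 y - qi x * qi y - qj x * qj y - qk x * qk y)
  (q1 x * qi y + qi x * q1 y + qj x * qk y - qk x * qj y)
  (q1 x * qj y - qi x * qk y + qj x * q1 y + qk x * qi y)
  (q1 x * qk y + qi x * qj y - qj x * qi y + qk x * q1 y).

Let quatE a b c d a' b' c' d' :
  a = a' -> b = b' -> c = c' -> d = d' -> Quat a b c d = Quat a' b' c' d' :> quat F.
Proof. by move=> -> -> -> ->. Qed.

Lemma quat_addA : associative quat_add.
Proof. by move=> x y z; apply: quatE => /=; ring. Qed.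
Lemma quat_addC : commutative quat_add.
Proof. by move=> x y; apply: quatE => /=; ring. Qed.
Lemma quat_add0 : left_id quat0 quat_add.
Proof. by case=> a b c d; apply: quatE => /=; ring. Qed.
Lemma quat_addN : left_inverse quat0 quat_opp quat_add.
Proof. by case=> a b c d; apply: quatE => /=; ring. Qed.

HB.instance Definition _ := GRing.isZmodule.Build (quat F)
  quat_addA quat_addC quat_add0 quat_addN.

Lemma quat_mulA : associative quat_mul.
Proof. by move=> x y z; apply: quatE => /=; ring. Qed.
Lemma quat_mul1l : left_id quat_one quat_mul.
Proof. by case=> a b c d; apply: quatE => /=; ring. Qed.
Lemma quat_mul1r : right_id quat_one quat_mul.
Proof. by case=> a b c d; apply: quatE => /=; ring. Qed.
Lemma quat_mulDl : left_distributive quat_mul +%R.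
Proof. by move=> x y z; apply: quatE => /=; ring. Qed.
Lemma quat_mulDr : right_distributive quat_mul +%R.
Proof. by move=> x y z; apply: quatE => /=; ring. Qed.
Lemma quat_one_neq0 : quat_one != 0.
Proof. by apply/eqP => -[/eqP]; rewrite oner_eq0. Qed.

HB.instance Definition _ := GRing.Zmodule_isNzRing.Build (quat F)
  quat_mulA quat_mul1l quat_mul1r quat_mulDl quat_mulDr quat_one_neq0.

End QuatRing.

Section MatrixRep.
Variables (D : nzRingType) (gT : finGroupType).

(* D-linear actions of G on the right D-module D^n of column vectors; over a  *)
(* division ring every finitely generated right module is of this form.       *)
Structure matrix_rep (G : {group gT}) (n : nat) := MatrixRep {
  rep_mx :> gT -> 'M[D]_n;
  rep_mxP : rep_mx 1%g = 1%:M /\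
            {in G &, {morph rep_mx : x y / (x * y)%g >-> x *m y}} }.

Definition right_submodule n (U : 'cV[D]_n -> Prop) : Prop :=
  [/\ U 0, (forall u v, U u -> U v -> U (u + v))
    & (forall u (d : D), U u -> U (u *m d%:M))].

Definition rep_irreducible (G : {group gT}) n (rho : matrix_rep G n) : Prop :=
  (0 < n)%N /\
  forall U : 'cV[D]_n -> Prop, right_submodule U ->
    (forall x u, x \in G -> U u -> U (rho x *m u)) ->
    (forall u, U u -> u = 0) \/ (forall u, U u).

End MatrixRep.

Variant fs_type := FS_R | FS_C | FS_H.

Section AssociatedComplex.
Variables (R : rcfType) (gT : finGroupType).

Definition fs_ring (t : fs_type) : nzRingType :=
  match t with FS_R => R | FS_C => R[i] | FS_H => quat R end.

(* The embedding C -> H, i |-> i. Every quaternion is [z + j w] for unique    *)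
(* complex z, w; these are [quat_fst] and [quat_snd].                         *)
Definition quat_of_complex (z : R[i]) : quat R := Quat (Re z) (Im z) 0 0.
Definition quat_j : quat R := Quat 0 0 1 0.
Definition quat_fst (q : quat R) : R[i] := q1 q +i* qi q.
Definition quat_snd (q : quat R) : R[i] := qj q -i* qk q.

Lemma quat_decomp q :
  q = quat_of_complex (quat_fst q) + quat_j * quat_of_complex (quat_snd q).
Proof. by case: q => a b c d; congr Quat; rewrite /=; ring. Qed.

(* Multiplication by A on H^n as a complex matrix, in the C-basis             *)
(* e_1, .., e_n, e_1 j, .., e_n j of the right C-space H^n.                   *)
Definition complex_of_quat_mx n (A : 'M[quat R]_n) : 'M[R[i]]_(n + n) :=
  block_mx (map_mx quat_fst A) (- map_mx conjc (map_mx quat_snd A))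
           (map_mx quat_snd A) (map_mx conjc (map_mx quat_fst A)).

Definition quat_col n (v : 'cV[R[i]]_(n + n)) : 'cV[quat R]_n :=
  map_mx quat_of_complex (usubmx v) +
  quat_j *: map_mx quat_of_complex (dsubmx v).

Definition complex_col n (u : 'cV[quat R]_n) : 'cV[R[i]]_(n + n) :=
  col_mx (map_mx quat_fst u) (map_mx quat_snd u).

Lemma quat_colK n : cancel (@quat_col n) (@complex_col n).
Proof.
move=> v; rewrite /complex_col -[RHS]vsubmxK; congr col_mx; apply/matrixP=> i j;
rewrite !mxE; [case: (v (lshift _ _) _) | case: (v (rshift _ _) _)] => a b;
  case: (v _ _) => c d;
  by apply/eqP; rewrite eq_complex /=; apply/andP; split; apply/eqP; ring.
Qed.

Lemma complex_colK n : cancel (@complex_col n) (@quat_col n).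
Proof.
move=> u; rewrite /quat_col col_mxKu col_mxKd.
by apply/matrixP=> i j; rewrite !mxE -quat_decomp.
Qed.

Lemma quat_of_complexD : {morph quat_of_complex : x y / x + y}.
Proof. by case=> a b [c d]; congr Quat; rewrite /=; ring. Qed.

Lemma quat_of_complexM : {morph quat_of_complex : x y / x * y}.
Proof. by case=> a b [c d]; congr Quat; rewrite /=; ring. Qed.

Lemma quat_of_complex0 : quat_of_complex 0 = 0.
Proof. by []. Qed.

Lemma quat_colZ n (v : 'cV[R[i]]_(n + n)) (z : R[i]) :
  quat_col (z *: v) = quat_col v *m (quat_of_complex z)%:M.
Proof.
apply/matrixP=> i j; rewrite !mxE big_ord1 !mxE ord1 eqxx mulr1n.
by rewrite mulrDl -mulrA -!quat_of_complexM ![_ * z]mulrC.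
Qed.

Lemma quat_colM n (A : 'M[quat R]_n) (v : 'cV[R[i]]_(n + n)) :
  A *m quat_col v = quat_col (complex_of_quat_mx A *m v).
Proof.
have qs (I : finType) (f : I -> R[i]) :
    quat_of_complex (\sum_i f i) = \sum_i quat_of_complex (f i).
  exact: (big_morph _ quat_of_complexD quat_of_complex0).
rewrite -[v]vsubmxK; move: (usubmx v) (dsubmx v) => a b.
rewrite /complex_of_quat_mx mul_block_col /quat_col !col_mxKu !col_mxKd.
apply/matrixP=> i j; rewrite !mxE !quat_of_complexD !qs.
rewrite -!big_split mulr_sumr -big_split /=; apply: eq_bigr => k _; rewrite !mxE.
case: (A i k) => x y z t; case: (a k j) => a1 a2; case: (b k j) => b1 b2.
by congr Quat; rewrite /=; ring.
Qed.

Lemma complex_of_quat_mx1 n : complex_of_quat_mx (1%:M : 'M_n) = 1%:M.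
Proof.
have E (v : 'cV_(n + n)) : complex_of_quat_mx (1%:M : 'M_n) *m v = v.
  by apply: (can_inj (@quat_colK n)); rewrite -quat_colM mul1mx.
apply/matrixP=> i j.
by have /matrixP/(_ i ord0) := E (delta_mx j ord0); rewrite -!colE !mxE eqxx andbT.
Qed.

Lemma complex_of_quat_mxM n (A B : 'M[quat R]_n) :
  complex_of_quat_mx (A *m B) = complex_of_quat_mx A *m complex_of_quat_mx B.
Proof.
have E (v : 'cV_(n + n)) : complex_of_quat_mx (A *m B) *m v =
    complex_of_quat_mx A *m complex_of_quat_mx B *m v.
  by apply: (can_inj (@quat_colK n)); rewrite -quat_colM -!mulmxA -!quat_colM.
apply/matrixP=> i j.
by have /matrixP/(_ i ord0) := E (delta_mx j ord0); rewrite -!colE !mxE.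
Qed.

Definition assoc_dim (t : fs_type) (n : nat) : nat :=
  match t with FS_R => n | FS_C => n | FS_H => (n + n)%N end.

Definition assoc_mx (t : fs_type) (n : nat) :
    'M[fs_ring t]_n -> 'M[R[i]]_(assoc_dim t n) :=
  match t with
  | FS_R => fun A => map_mx (real_complex R) A
  | FS_C => fun A => A
  | FS_H => fun A => complex_of_quat_mx A
  end.

Lemma assoc_repr_subproof (G : {group gT}) t n
    (rho : matrix_rep (fs_ring t) G n) :
  mx_repr G (fun x => assoc_mx (rho x)).
Proof.
case: t rho => -[r [r1 rM]]; split=> [|x y Gx Gy] /=; rewrite ?r1 ?rM //.
- by rewrite map_mx1.
- by rewrite map_mxM.
- by rewrite complex_of_quat_mx1.
- by rewrite complex_of_quat_mxM.
Qed.

Definition assoc_repr (G : {group gT}) t n (rho : matrix_rep (fs_ring t) G n) :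
    mx_representation R[i] G (assoc_dim t n) :=
  MxRepresentation (assoc_repr_subproof rho).

End AssociatedComplex.

Section FrobeniusSchur.
Variables (F : fieldType) (gT : finGroupType) (G : {group gT}) (n : nat).
Variable phi : mx_representation F G n.

Lemma dual_repr_subproof : mx_repr G (fun x => (phi x^-1%g)^T).
Proof.
split=> [|x y Gx Gy]; first by rewrite invg1 repr_mx1 trmx1.
by rewrite invMg repr_mxM ?groupV // trmx_mul.
Qed.

Definition dual_repr : mx_representation F G n :=
  MxRepresentation dual_repr_subproof.

Definition self_dual : Prop := mx_rsim phi dual_repr.

Definition invariant_form (B : 'M[F]_n) : Prop :=
  B \in unitmx /\ forall x, x \in G -> (phi x)^T *m B *m phi x = B.

Definition symmetric_form (B : 'M[F]_n) : Prop :=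
  forall u v : 'cV[F]_n, u^T *m B *m v = v^T *m B *m u.

Definition alternating_form (B : 'M[F]_n) : Prop :=
  forall v : 'cV[F]_n, v^T *m B *m v = 0.

Definition has_fs_type (t : fs_type) : Prop :=
  match t with
  | FS_R => self_dual /\ exists2 B, invariant_form B & symmetric_form B
  | FS_C => ~ self_dual
  | FS_H => self_dual /\ exists2 B, invariant_form B & alternating_form B
  end.

End FrobeniusSchur.

Section Heisenberg.
Local Open Scope group_scope.
Variables (gT : finGroupType) (p : nat) (P : {group gT}).

Definition heisenberg_group : Prop :=
  [/\ #|'Z(P)| = p, abelian (P / 'Z(P)), exponent (P / 'Z(P)) <= p
    & p != 2 -> exponent P <= p]%N.

(* V is [P / 'Z(P)]; as its scalars form a prime field, its subspaces are its *)
(* subgroups. The forms are given through representatives in P: the value of  *)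
(* omega_P at the classes of x and y is [omega x y], and Q_P at the class of  *)
(* x is [x ^+ 2]. Their zero value is [1 \in 'Z(P)].                          *)
Definition omega (x y : gT) : gT := x * y * x^-1 * y^-1.

Definition isotropic (W : {group coset_of 'Z(P)}) : Prop :=
  W \subset P / 'Z(P) /\
  if p == 2%N then
    {in P, forall x, coset 'Z(P) x \in W -> x ^+ 2 = 1}
  else
    {in P &, forall x y,
      coset 'Z(P) x \in W -> coset 'Z(P) y \in W -> omega x y = 1}.

Definition splitting (W : {group coset_of 'Z(P)}) (S : {group gT}) : Prop :=
  S \subset P /\ isom S W (coset 'Z(P)).

Definition AutZ : {set {perm gT}} := 'C_(Aut P)('Z(P) | 'P).

(* Preimage in P of the omega_P-orthogonal complement of W.                   *)
Definition perp_preim (W : {group coset_of 'Z(P)}) : {set gT} :=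
  [set x in P | [forall y in P, (coset 'Z(P) y \in W) ==> (omega x y == 1)]].

(* The group written P(0 x V^+); [S] is 0 x V^+ and [perp_preim W] is         *)
(* V^+ x P_0, whatever the choice of V_0: see [perp_preim_polarization].      *)
Definition parabolic (W : {group coset_of 'Z(P)}) (S : {group gT}) :
    {set {perm gT}} :=
  [set g in AutZ | (g @: S == S) &&
     [forall x in perp_preim W, g x * x^-1 \in S]].

(* For p = 2, Q_P is nondegenerate when its associated bilinear form omega_P  *)
(* is.                                                                        *)
Definition partial_polarization (Vp V0 Vm : {group coset_of 'Z(P)}) : Prop :=
  [/\ [/\ isotropic Vp, isotropic Vm & V0 \subset P / 'Z(P)],
      Vp \x V0 \x Vm = P / 'Z(P),
      {in P &, forall x y, coset 'Z(P) x \in V0 ->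
        coset 'Z(P) y \in Vp * Vm -> omega x y = 1}
    & {in P, forall x, coset 'Z(P) x \in V0 ->
        {in P, forall y, coset 'Z(P) y \in V0 -> omega x y = 1} ->
        x \in 'Z(P)}].

Lemma omega_eq1 x y : (omega x y == 1) = (x * y == y * x).
Proof. by rewrite /omega -mulgA -invMg -eq_mulgV1. Qed.

Lemma perp_preim_polarization (Vp V0 Vm : {group coset_of 'Z(P)})
    (S : {group gT}) :
  heisenberg_group -> partial_polarization Vp V0 Vm -> splitting Vp S ->
  S \x (coset 'Z(P) @*^-1 V0) = perp_preim Vp.
Proof.
move=> _ [[isoP isoM sV0] dV oV0 _] [sSP isoS].
have nZ x : x \in P -> x \in 'N('Z(P)).
  exact: (subsetP (gFnorm _ _)).
have cosM : {in P &, {morph coset 'Z(P) : x y / x * y}}.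
  by move=> x y Px Py; apply: morphM => /=; apply: nZ.
have cosV : {in P, {morph coset 'Z(P) : x / x^-1}}.
  by move=> x Px; apply: morphV => /=; apply: nZ.
have om x y : omega x y = 1 -> x * y = y * x.
  by move/eqP; rewrite omega_eq1 => /eqP.
have sSN : S \subset 'N('Z(P)) by apply: subset_trans sSP (gFnorm _ _).
have isoS' : isom S Vp (restrm_morphism sSN (coset_morphism 'Z(P))) := isoS.
have [injS] := isomP isoS'; rewrite morphim_restrm setIid => imS.
have cosS x : x \in S -> coset 'Z(P) x \in Vp.
  move=> Sx; rewrite -imS; apply: mem_morphim => //=.
  by apply: nZ; apply: (subsetP sSP).
have inP (W : {group coset_of 'Z(P)}) x : W \subset P / 'Z(P) ->
    x \in 'N('Z(P)) -> coset 'Z(P) x \in W -> x \in P.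
  move=> sW nx /(subsetP sW) /morphimP [y ny Py exy].
  have : x \in 'Z(P) :* y.
    by rewrite -val_coset // -exy val_coset // rcoset_refl.
  by case/rcosetP=> z /(subsetP (center_sub _)) Pz ->; rewrite groupM.
have isoC W : isotropic W -> {in P &, forall x y,
    coset 'Z(P) x \in W -> coset 'Z(P) y \in W -> x * y = y * x}.
  case=> _; case: (p == 2) => isoW x y Px Py Wx Wy; last exact/om/isoW.
  have sq z : z \in P -> coset 'Z(P) z \in W -> z^-1 = z.
    by move=> Pz Wz; apply/eqP; rewrite eq_invg_mul -expg2; apply/eqP/isoW.
  rewrite -[LHS]sq ?groupM //; first by rewrite invMg !sq.
  by rewrite cosM // groupM.
have [[K _ eK _] eKM _ _] := dprodP dV.
have [_ eKV _ tiV] := dprodP eK.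
have dprodV x : x \in P / 'Z(P) -> exists vp v0 vm,
    [/\ vp \in Vp, v0 \in V0, vm \in Vm & x = vp * v0 * vm].
  rewrite -eKM eK -eKV => /mulsgP[u vm /mulsgP[vp v0 ? ? ->] ? ->].
  by exists vp, v0, vm.
have P0E x : (x \in coset 'Z(P) @*^-1 V0) =
    (x \in 'N('Z(P))) && (coset 'Z(P) x \in V0) by rewrite !inE.
have sP0 : coset 'Z(P) @*^-1 V0 \subset P.
  by apply/subsetP=> x; rewrite P0E => /andP[nx V0x]; exact: (inP V0).
have oP0 x y : x \in coset 'Z(P) @*^-1 V0 -> y \in P ->
    coset 'Z(P) y \in Vp * Vm -> x * y = y * x.
  move=> P0x Py Vy; apply: om; apply: oV0 => //; first exact: (subsetP sP0).
  by move: P0x; rewrite P0E => /andP[].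
have inl v : v \in Vp -> v \in Vp * Vm by apply: (subsetP (mulG_subl _ _)).
have inr v : v \in Vm -> v \in Vp * Vm by apply: (subsetP (mulG_subr _ _)).
have tiS : S :&: coset 'Z(P) @*^-1 V0 = 1.
  apply/trivgP/subsetP=> x; rewrite inE => /andP[Sx].
  rewrite P0E => /andP[_ V0x].
  have : coset 'Z(P) x \in Vp :&: V0 by rewrite inE V0x cosS.
  rewrite tiV => /set1P cx1; apply/set1P; apply: (injmP injS) => //.
  by rewrite morph1; exact: cx1.
have cS : coset 'Z(P) @*^-1 V0 \subset 'C(S).
  apply/centsP=> x P0x s Ss; apply: oP0 => //; first exact: (subsetP sSP).
  exact/inl/cosS.
rewrite (dprodE cS tiS).
apply/eqP; rewrite eqEsubset; apply/andP; split; apply/subsetP=> x.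
- case/mulsgP=> s x0 Ss P0x ->; have Ps := subsetP sSP s Ss.
  have Px := subsetP sP0 _ P0x; rewrite inE groupM //=.
  apply/forall_inP=> y Py; apply/implyP=> Vy; rewrite omega_eq1; apply/eqP.
  rewrite -mulgA (oP0 x0) ?inl // !mulgA; congr (_ * _).
  by apply: (isoC _ isoP) => //; apply: cosS.
rewrite inE => /andP[Px /forall_inP cx].
have {}cx y : y \in P -> coset 'Z(P) y \in Vp -> x * y = y * x.
  by move=> Py Vy; move/implyP: (cx y Py) => /(_ Vy); rewrite omega_eq1 => /eqP.
have [|vp [v0 [vm [Vvp Vv0 Vvm ex]]]] := dprodV (coset 'Z(P) x).
  by rewrite mem_morphim // nZ.
move: Vvp ex; rewrite -imS => /morphimP[s _ Ss ->] ex.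
have Ps := subsetP sSP s Ss.
have /morphimP[x0 _ Px0 ex0] := subsetP sV0 _ Vv0.
have P0x0 : x0 \in coset 'Z(P) @*^-1 V0 by rewrite P0E nZ //= -ex0.
pose m := (s * x0)^-1 * x.
have Pm : m \in P by rewrite groupM ?groupV ?groupM.
have em : coset 'Z(P) m = vm.
  by rewrite cosM ?groupV ?groupM // cosV ?groupM // cosM // ex ex0 mulKg.
have Vm_m : coset 'Z(P) m \in Vm by rewrite em.
have cm y : y \in P -> coset 'Z(P) y \in Vp -> m * y = y * m.
  move=> Py Vy; apply/commute_sym/commuteM; last by symmetry; apply: cx.
  apply/commuteV/commuteM.
    by apply: (isoC _ isoP) => //; apply: cosS.
  by symmetry; apply: oP0 => //; apply: inl.
have Zm : m \in 'Z(P).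
  apply/centerP; split=> // y Py.
  have [|yp [y0 [ym [Vyp Vy0 Vym ey]]]] := dprodV (coset 'Z(P) y).
    by rewrite mem_morphim // nZ.
  move: Vyp ey; rewrite -imS => /morphimP[t _ St ->] ey.
  have Pt := subsetP sSP t St.
  have /morphimP[z0 _ Pz0 ez0] := subsetP sV0 _ Vy0.
  have P0z0 : z0 \in coset 'Z(P) @*^-1 V0 by rewrite P0E nZ //= -ez0.
  pose k := (t * z0)^-1 * y.
  have ek : coset 'Z(P) k = ym.
    by rewrite cosM ?groupV ?groupM // cosV ?groupM // cosM // ey ez0 mulKg.
  have -> : y = t * z0 * k by rewrite mulKVg.
  apply: commuteM.
    apply: commuteM; first by apply: cm => //; apply: cosS.
    by symmetry; apply: oP0 => //; apply: inr.
  apply: (isoC _ isoM) => //; last by rewrite ek.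
  by rewrite groupM ?groupV ?groupM.
have -> : x = s * (x0 * m) by rewrite mulgA mulKVg.
apply: mem_mulg => //; rewrite groupM // P0E nZ //=.
by rewrite coset_id // group1.
Qed.

End Heisenberg.

Section HeisenbergRep.
Variables (R : rcfType) (gT : finGroupType) (P : {group gT}).

Definition central_character (psi : gT -> R[i]) : Prop :=
  psi 1%g = 1 /\
  {in 'Z(P)%g &, {morph psi : x y / (x * y)%g >-> x * y}}.

Definition nontrivial_character (psi : gT -> R[i]) : Prop :=
  exists2 z, z \in 'Z(P)%g & psi z != 1.

Definition heisenberg_repr (psi : gT -> R[i]) n
    (phi : mx_representation R[i] P n) : Prop :=
  mx_irreducible phi /\ forall z, z \in 'Z(P)%g -> phi z = (psi z)%:M.

Definition heisenberg_Rrep t n (phi : mx_representation R[i] P n) m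
    (rho : matrix_rep (fs_ring R t) P m) : Prop :=
  rep_irreducible rho /\ mx_rsim (assoc_repr rho) phi.

End HeisenbergRep.

Section SemiDirect.
Variables (gT : finGroupType) (P : {group gT}) (A : {group {perm gT}}).
Hypothesis sA : A \subset AutZ P.

Definition AutZ_gact : groupAction A P :=
  ([Aut P] \ subset_trans sA (subsetIl _ _))%gact.

(* Permutations compose left to right in the library, so here                 *)
(* [x ^ a = a x] and conjugation by a^-1 is the automorphism a.               *)
Definition semidirect := sdprod_by AutZ_gact.

Definition in_semidirect (x : gT) : semidirect := sdpair1 AutZ_gact x.

Definition extends_to_semidirect (D : nzRingType) n
    (rho : matrix_rep D P n) : Prop :=
  exists rho' : matrix_rep D [set: semidirect]%G n,
    {in P, forall x, rho' (in_semidirect x) = rho x}.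

End SemiDirect.

(* Main.v *)
Require Import Defs.
From HB Require Import structures.
From mathcomp Require Import all_boot all_order all_algebra all_fingroup.
From mathcomp Require Import all_solvable all_field all_character.
From mathcomp Require Import complex reals ring.

Set Implicit Arguments.
Unset Strict Implicit.
Unset Printing Implicit Defensive.

Import GroupScope GRing.Theory Num.Theory.
Local Open Scope ring_scope.

(** Write phi for the complex representation attached to the given
R-representation of P; it is irreducible, and the centre acts through the
faithful character psi.  Because commutators are central, phi x is conjugate
to a multiple c *: phi x with c <> 1 as soon as x is not central, so the
character of phi vanishes off the centre ([mxtrace_off_center]).  Two things
follow by averaging over P.  For every automorphism a acting trivially on the
centre there is an invertible T_a with phi x T_a = T_a phi (a x)
([exists_intertwiner], [intertwiner_unit]), unique up to a scalar
([intertwiner_unique]); and the square of the degree of phi times the order of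
the centre is the order of P ([square_degree]), so that the degree is a power
of p.

The T_a form a projective representation of A, with T_a T_b = c(a, b) T_(a b),
and the point is to rescale them so that c becomes 1.  Two independent reasons
make powers of the class of c trivial.
- Taking determinants shows that c^deg is a coboundary.
- On the Sylow subgroup A_p the class is trivial.  Indeed T_a, for a in A_p,
preserves the vectors fixed by the splitting S = 0 x V^+, and it commutes there
with the centraliser of S in P, because a moves an element of that centraliser
only by an element of S.  This centraliser acts irreducibly on the fixed
vectors, so T_a acts on them by a scalar ([intertwiner_scalar_on_fixed]), and
asking this scalar to be 1 picks multiplicative choices on A_p.  A transfer
argument then makes c^[A : A_p] a coboundary ([cocycle_transferM]).
The degree is a power of p and [A : A_p] is prime to p, so a Bezout combination
of the two correcting factors makes c itself a coboundary
([linearise_proj_rep]).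

To stay inside R-linear maps, the matrices coming from R are described as the
fixed points of a semilinear multiplicative involution theta of the complex
matrices: the identity for type C, entrywise conjugation for type R, and
conjugation twisted by the quaternionic structure for type H
([fs_real_form], [assoc_mx_onto]).  Any nonzero intertwiner can be averaged
into a theta-fixed one, every scalar occurring above is then fixed by the
conjugation, and so are the correcting factors, which are explicit products of
values of c and of determinants.  Hence the final operators are again
R-linear, and with rho they define the representation of the semidirect
product ([extends_of_intertwiners]). *)

(** * Linearising a projective representation *)

Lemma unitmx_neq0 (F : fieldType) n (M : 'M[F]_n) :
  (0 < n)%N -> M \in unitmx -> M != 0.
Proof.
case: n M => // n M _; apply: contraTneq => ->.
by rewrite unitmxE det0 unitr0.
Qed.

Lemma scalemxI (F : fieldType) n (M : 'M[F]_n) (x y : F) :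
  M != 0 -> x *: M = y *: M -> x = y.
Proof.
move=> M0 /eqP; rewrite -subr_eq0 -scalerBl scaler_eq0 (negPf M0) orbF.
by rewrite subr_eq0 => /eqP.
Qed.

Section Transfer.

Variables (F : fieldType) (gT : finGroupType) (A B : {group gT}).
Hypothesis sBA : B \subset A.
Variable c : gT -> gT -> F.
Hypothesis c_neq0 : {in A &, forall a b, c a b != 0}.
Hypothesis c_cocycle : {in A & &, forall a b d,
  c a b * c (a * b)%g d = c b d * c a (b * d)%g}.
Hypothesis c_inv : {in B & A &, forall b a d, c (b * a)%g d = c a d}.

(** The value at [a] of the cochain whose coboundary is the [#|A : B|]-th power
of [c]; since [c] is invariant under [B] on the left in its first argument, the
representatives of the right cosets of [B] may be chosen arbitrarily. *)
Definition cocycle_transfer a := \prod_(X in rcosets B A) c (repr X) a.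

Lemma mem_repr_rcosets X : X \in rcosets B A -> repr X \in A.
Proof.
case/rcosetsP=> a Aa ->; have := mem_repr_rcoset B a.
by apply: subsetP; rewrite mul_subG ?sub1set.
Qed.

Lemma cocycle_transfer_neq0 a : a \in A -> cocycle_transfer a != 0.
Proof.
by move=> Aa; apply/prodf_neq0=> X /mem_repr_rcosets Ar; apply: c_neq0.
Qed.

(** Multiply the cocycle identity at [(r, a, b)] over representatives [r] of the
right cosets of [B]: right translation by [a] permutes these cosets, so the
factors [c (r * a) b] recombine into the transfer of [b]. *)
Lemma cocycle_transferM : {in A &, forall a b,
  cocycle_transfer a * cocycle_transfer b =
  c a b ^+ #|A : B|%g * cocycle_transfer (a * b)%g}.
Proof.
move=> a b Aa Ab; rewrite /cocycle_transfer -prodr_const.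
have -> : \prod_(X in rcosets B A) c (repr X) b =
          \prod_(X in rcosets B A) c (repr X * a)%g b.
  rewrite (reindex_inj (act_inj 'Rs%act a)) /=.
  apply: eq_big => [X | X rX]; first exact: (actsP (actsRs_rcosets B A)).
  have {}rX : X \in rcosets B A.
    by rewrite -(actsP (actsRs_rcosets B A) a Aa).
  have Ar := mem_repr_rcosets rX; case/rcosetsP: rX => r Rr dX.
  have: repr (rcoset X a) \in B :* (repr X * a)%g.
    rewrite dX rcosetE rcosetM rcoset_repr -rcosetM mem_repr_rcoset //.
  case/rcosetP=> u Bu /= ->; rewrite c_inv ?groupM //.
rewrite -!big_split /=; apply: eq_bigr => X rX.
by rewrite c_cocycle // mem_repr_rcosets.
Qed.

End Transfer.

Section Linearise.

Variables (F : fieldType) (gT : finGroupType) (A B : {group gT}) (n : nat).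
Hypothesis sBA : B \subset A.
Variables (T S : gT -> 'M[F]_n) (c : gT -> gT -> F).
Hypothesis n_gt0 : (0 < n)%N.
Hypothesis T_unit : {in A, forall a, T a \in unitmx}.
Hypothesis T_proj : {in A &, forall a b, T a *m T b = c a b *: T (a * b)%g}.
Hypothesis T_coset : {in B & A, forall b a, T (b * a)%g = S b *m T a}.
Hypothesis index_coprime : coprime n #|A : B|%g.

(** Determinants kill the [n]-th power of the class of [c] and the transfer from
[B] kills its [#|A : B|]-th power; a Bezout relation between these coprime
exponents gives the correction.  Its explicit form is recorded in order to see
that it lies in any subfield containing the values of [c] and the
determinants. *)
Lemma linearise_proj_rep : exists g : gT -> F,
  [/\ {in A, forall a, g a != 0},
      {in A &, forall a b, (g a *: T a) *m (g b *: T b) =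
                           g (a * b)%g *: T (a * b)%g}
    & exists u v, {in A, forall a,
        g a = cocycle_transfer A B c a ^+ u / \det (T a) ^+ v}].
Proof.
have T_neq0 a : a \in A -> T a != 0.
  by move=> Aa; apply: unitmx_neq0 (T_unit Aa).
have T_inj a x y : a \in A -> x *: T a = y *: T a -> x = y.
  by move=> Aa; apply/scalemxI/T_neq0.
have c_neq0 : {in A &, forall a b, c a b != 0}.
  move=> a b Aa Ab; have: T a *m T b \in unitmx by rewrite unitmx_mul !T_unit.
  move/(unitmx_neq0 n_gt0); rewrite T_proj //.
  by apply: contraNneq => ->; rewrite scale0r.
have c_coc : {in A & &, forall a b d,
    c a b * c (a * b)%g d = c b d * c a (b * d)%g}.
  move=> a b d Aa Ab Ad; apply: (@T_inj (a * b * d)%g); rewrite ?groupM //.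
  have E1 : T a *m T b *m T d = (c a b * c (a * b)%g d) *: T (a * b * d)%g.
    by rewrite T_proj // -scalemxAl T_proj ?groupM // scalerA.
  rewrite -E1 -mulmxA T_proj // -scalemxAr T_proj ?groupM // scalerA.
  by rewrite mulgA.
have c_inv : {in B & A &, forall b a d, c (b * a)%g d = c a d}.
  move=> b a d Bb Aa Ad; have Ab := subsetP sBA b Bb.
  apply: (@T_inj (b * a * d)%g); rewrite ?groupM // -T_proj ?groupM //.
  by rewrite (T_coset Bb) // -mulmxA T_proj // -scalemxAr -mulgA (T_coset Bb) ?groupM.
have f_neq0 := cocycle_transfer_neq0 sBA c_neq0.
have fM := cocycle_transferM sBA c_coc c_inv.
have dM a b : a \in A -> b \in A ->
    \det (T a) * \det (T b) = c a b ^+ n * \det (T (a * b)%g).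
  by move=> Aa Ab; rewrite -det_mulmx T_proj // detZ.
have d_neq0 a : a \in A -> \det (T a) != 0.
  by move=> Aa; rewrite -unitfE -unitmxE T_unit.
(* u * n = v * #|A : B| + 1, which is why v sits on the transfer and u on the
   inverse of the determinant. *)
have [u v uv _] := egcdnP #|A : B|%g n_gt0.
rewrite (eqP index_coprime) in uv.
exists (fun a => cocycle_transfer A B c a ^+ v / \det (T a) ^+ u).
split=> [a Aa|a b Aa Ab|].
- by rewrite mulf_neq0 ?invr_eq0 ?expf_neq0 ?d_neq0 ?f_neq0.
- rewrite -scalemxAl -scalemxAr T_proj // !scalerA; congr (_ *: _).
  rewrite mulrACA -exprMn fM // -invfM -exprMn dM // !exprMn -!exprM.
  rewrite (mulnC n) uv addn1 exprS (mulnC v).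
  have x0 := c_neq0 _ _ Aa Ab.
  have := expf_neq0 (#|A : B|%g * v) x0.
  have := expf_neq0 u (d_neq0 _ (groupM Aa Ab)).
  move: (c a b) (_ ^+ (#|A : B|%g * v)) (cocycle_transfer _ _ _ _ ^+ v) (_ ^+ u) x0.
  move=> x y w z x0 z0 y0; field.
  by rewrite x0 y0 z0.
- by exists v, u.
Qed.

End Linearise.

(** * Automorphisms trivial on the centre *)

Section AutZ.

Variables (gT : finGroupType) (P : {group gT}) (a : {perm gT}).
Hypothesis aP : a \in AutZ P.

Lemma AutZ_closed x : x \in P -> a x \in P.
Proof. by case/setIP: aP => autA _; apply: Aut_closed. Qed.

Lemma AutZM : {in P &, {morph a : x y / (x * y)%g}}.
Proof. by case/setIP: aP => /Aut_morphic/morphicP. Qed.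

Lemma AutZV : {in P, {morph a : x / x^-1%g}}.
Proof.
move=> x Px; apply/eqP; rewrite eq_sym eq_invg_mul -AutZM ?groupV //.
by rewrite mulgV; case/setIP: aP => autA _; rewrite -(autmE autA) morph1.
Qed.

Lemma AutZ_fix : {in 'Z(P)%g, forall z, a z = z}.
Proof. by case/setIP: aP => _ /astabP fixZ z /fixZ. Qed.

End AutZ.

(** * Representations whose character is supported on the centre *)

Lemma mulmx_deltaE (F : comNzRingType) m n p q (M : 'M[F]_(m, n)) (N : 'M_(p, q))
    i j k l : (M *m delta_mx i j *m N) k l = M k i * N j l.
Proof.
rewrite mxE (bigD1 j) //= [X in _ + X]big1 => [|j' nj]; last first.
  by rewrite mxE big1 ?mul0r // => i' _; rewrite mxE (negPf nj) andbF mulr0.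
rewrite addr0 mxE (bigD1 i) //= big1 => [|i' ni]; last first.
  by rewrite mxE (negPf ni) mulr0.
by rewrite mxE !eqxx mulr1 addr0.
Qed.

Section CentralType.

Variables (F : numFieldType) (gT : finGroupType) (P : {group gT}) (n : nat).
Variables (phi : mx_representation F P n) (psi : gT -> F).
Hypothesis abs_irr : mx_absolutely_irreducible phi.
Hypothesis class2 : {in P &, forall x y, [~ x, y]%g \in 'Z(P)%g}.
Hypothesis phiZ : {in 'Z(P)%g, forall z, phi z = (psi z)%:M}.
Hypothesis psi_inj : {in 'Z(P)%g, forall z, psi z = 1 -> z = 1%g}.

Let sZP : {subset 'Z(P)%g <= P}.
Proof. exact/subsetP/center_sub. Qed.

Let n_gt0 : (0 < n)%N.
Proof. by case/mx_abs_irrP: abs_irr. Qed.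

Let n_neq0 : n%:R != 0 :> F.
Proof. by rewrite pnatr_eq0 -lt0n. Qed.

Let phi_unit x : x \in P -> phi x \in unitmx.
Proof. exact: repr_mx_unit. Qed.

Lemma psi_neq0 z : z \in 'Z(P)%g -> psi z != 0.
Proof.
move=> Zz; apply: contraTneq (phi_unit (sZP Zz)) => z0.
rewrite phiZ // z0.
by apply: contraTN (n_gt0) => /(unitmx_neq0 n_gt0); rewrite raddf0 eqxx.
Qed.

Lemma repr_commg x y : x \in P -> y \in P ->
  phi x *m phi y = psi [~ x, y]%g *: (phi y *m phi x).
Proof.
move=> Px Py; rewrite -!repr_mxM // [in LHS]commgC.
rewrite (repr_mxM phi (groupM Py Px) (groupR Px Py)).
by rewrite (phiZ (class2 Px Py)) mul_mx_scalar.
Qed.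

Lemma off_center_comm x : x \in P -> x \notin 'Z(P)%g ->
  exists2 y, y \in P & psi [~ x, y]%g != 1.
Proof.
move=> Px; rewrite inE Px /= => /centP Cx.
have /existsP[y /andP[Py nxy]] : [exists y in P, x * y != y * x]%g.
  apply: contra_notT Cx; rewrite negb_exists => /forallP xC y Py.
  by have := xC y; rewrite Py negbK => /eqP.
exists y => //; apply: contraNneq nxy => /(psi_inj (class2 Px Py)) xy1.
by rewrite commgC xy1 mulg1.
Qed.

(** [phi x] is conjugate to [psi [~ x, y] *: phi x], and [y] can be chosen so that
this scalar is not [1]. *)
Lemma mxtrace_off_center x : x \in P -> x \notin 'Z(P)%g -> \tr (phi x) = 0.
Proof.
move=> Px /(off_center_comm Px)[y Py psi1].
have: \tr (phi x) = psi [~ x, y]%g * \tr (phi x).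
  rewrite -{1}[phi x](mulmxK (phi_unit Py)) repr_commg // -scalemxAl mxtraceZ.
  by rewrite mxtrace_mulC mulmxA mulVmx ?mul1mx // phi_unit.
move/eqP; rewrite -subr_eq0 -{1}[\tr _]mul1r -mulrBl mulf_eq0 subr_eq0.
by rewrite eq_sym (negPf psi1) => /eqP.
Qed.

Definition intertwines (a : {perm gT}) (T : 'M[F]_n) :=
  forall x, x \in P -> phi x *m T = T *m phi (a x).

(** The projection, up to the factor [#|P|], of a matrix onto the intertwiners
between [phi] and its twist by [a]. *)
Definition average (a : {perm gT}) M : 'M[F]_n :=
  \sum_(x in P) phi x *m M *m phi (a x)^-1%g.

Lemma average_intertwines a M : a \in AutZ P -> intertwines a (average a M).
Proof.
move=> aP y Py; rewrite mulmx_sumr mulmx_suml.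
rewrite (reindex_inj (mulgI y^-1%g)) /=; apply: eq_big => [x|x].
  by rewrite groupMl ?groupV.
rewrite groupMl ?groupV // => Px; have aPP := AutZ_closed aP.
rewrite !mulmxA -repr_mxM ?groupM ?groupV // mulKVg -!mulmxA; congr (_ *m (_ *m _)).
rewrite -repr_mxM ?groupV ?aPP //; congr (phi _).
by rewrite (AutZM aP) ?groupV // (AutZV aP) // invMg invgK.
Qed.

(** The left-hand side is the coefficient [(k, k)] of the sum over [x] of
[\tr (phi x) *: phi (a x)^-1]; only the centre contributes, and [a] fixes it.
This single identity yields both a nonzero intertwiner and, for [a = 1], the
degree of [phi]. *)
Lemma sum_average_delta a k : a \in AutZ P ->
  \sum_i average a (delta_mx i k) i k = (n * #|'Z(P)%g|)%:R.
Proof.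
move=> aP; under eq_bigr do rewrite summxE.
rewrite exchange_big /= (big_setID 'Z(P)%g) /= [X in _ + X]big1 => [|x]; last first.
  case/setDP=> Px nZx; under eq_bigr do rewrite mulmx_deltaE.
  by rewrite -mulr_suml -[\sum_i _]/(\tr (phi x)) mxtrace_off_center ?mul0r.
have -> : P :&: 'Z(P)%g = 'Z(P)%g by apply/setIidPr/center_sub.
rewrite addr0 mulnC natrM -sumr_const mulr_suml; apply: eq_bigr => z Zz.
under eq_bigr do rewrite mulmx_deltaE.
rewrite -mulr_suml -[\sum_i _]/(\tr (phi z)) (AutZ_fix aP) //.
rewrite repr_mxV ?sZP // phiZ // mxtrace_scalar invmx_scalar !mxE eqxx mulr1n.
by rewrite -[psi z *+ n]mulr_natr mulrAC mulfV // psi_neq0.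
Qed.

Lemma exists_intertwiner a : a \in AutZ P -> exists2 T, intertwines a T & T != 0.
Proof.
move=> aP; pose k := Ordinal n_gt0.
have [/existsP[i nz] | /existsPn z] :=
    boolP [exists i, average a (delta_mx i k) != 0].
  by exists (average a (delta_mx i k)) => //; apply: average_intertwines.
have /eqP := sum_average_delta k aP; rewrite big1 => [|i _].
  by rewrite eq_sym pnatr_eq0 -[_ == _]negbK -lt0n muln_gt0 n_gt0 cardG_gt0.
by rewrite (eqP (negbNE (z i))) mxE.
Qed.

(** Schur: the kernel of an intertwiner is a submodule for [phi]. *)
Lemma intertwiner_unit a T :
  intertwines a T -> T != 0 -> T \in unitmx.
Proof.
move=> TP T0; rewrite -row_free_unit -kermx_eq0.
have /mx_irrP[_ irrP] := mx_abs_irrW abs_irr.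
have modK : mxmodule phi (kermx T).
  apply/mxmoduleP=> x Px; apply/sub_kermxP.
  by rewrite -mulmxA TP // mulmxA mulmx_ker mul0mx.
apply: contraNT T0 => /(irrP _ modK); rewrite -sub1mx => /sub_kermxP.
by rewrite mul1mx => ->.
Qed.

Lemma intertwiner_unique a T T' :
  intertwines a T -> intertwines a T' -> T \in unitmx ->
  exists c, T' = c *: T.
Proof.
move=> TP TP' uT.
have /(mx_abs_irr_cent_scalar abs_irr)/is_scalar_mxP[c dc] :
    centgmx phi (T' *m invmx T).
  apply/centgmxP=> x Px; rewrite mulmxA TP' // -!mulmxA; congr (_ *m _).
  by apply: (can_inj (mulmxK uT)); rewrite mulmxKV // -mulmxA TP // mulKmx.
by exists c; rewrite -mul_scalar_mx -dc mulmxKV.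
Qed.

(** By Schur each [average 1 (delta_mx i k)] is a scalar matrix, whose value is
read off from its trace and substituted in [sum_average_delta]. *)
Lemma square_degree : (n ^ 2 * #|'Z(P)%g| = #|P|)%N.
Proof.
have P1 : 1%g \in AutZ P by exact: group1.
pose k := Ordinal n_gt0.
have avgE i : average 1 (delta_mx i k) = (#|P|%:R * (i == k)%:R / n%:R)%:M.
  have /(mx_abs_irr_cent_scalar abs_irr)/is_scalar_mxP[c dc] :
      centgmx phi (average 1 (delta_mx i k)).
    apply/centgmxP=> x Px; have := average_intertwines (delta_mx i k) P1 Px.
    by rewrite perm1.
  rewrite dc; congr (_%:M); apply: (canRL (mulfK n_neq0)).
  have -> : c * n%:R = \tr (average 1 (delta_mx i k)).
    by rewrite dc mxtrace_scalar mulr_natr.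
  rewrite raddf_sum /= mulr_natl -sumr_const.
  apply: eq_bigr => x Px; rewrite perm1 -mulmxA mxtrace_mulC -mulmxA.
  rewrite -repr_mxM ?groupV // mulVg repr_mx1 mulmx1.
  rewrite /mxtrace (bigD1 i) //= big1 ?addr0 ?mxE ?eqxx // => j ji.
  by rewrite mxE (negPf ji).
have := sum_average_delta k P1; rewrite (bigD1 k) //= big1 => [|i ik]; last first.
  by rewrite avgE !mxE (negPf ik).
rewrite avgE mxE !eqxx mulr1n mulr1 addr0 => /(congr1 ( *%R^~ n%:R)).
rewrite /= divfK // -natrM => /eqP; rewrite eqr_nat => /eqP->.
by rewrite mulnAC mulnn.
Qed.

End CentralType.

(** * Real forms of matrix algebras *)

(** The fixed points of [theta] play the part of the matrices with entries in
the algebra from which the complex ones are obtained, and those of [conj] the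
part of its central scalars.  The last field excludes a [theta] acting as
[-1] on a line, whose matrices would all average to zero. *)
Record real_form (F : fieldType) n (conj : {rmorphism F -> F})
    (theta : 'M[F]_n -> 'M[F]_n) : Prop := RealForm {
  real_formD : {morph theta : M N / M + N};
  real_formZ : forall c M, theta (c *: M) = conj c *: theta M;
  real_formM : {morph theta : M N / M *m N};
  real_form_det : forall M, \det (theta M) = conj (\det M);
  real_formK : involutive theta;
  real_form_nontrivial : forall M, M != 0 ->
    exists c, c *: M + theta (c *: M) != 0
}.

(** * Linear action of a group of automorphisms *)

Section Extension.

Variables (F : numFieldType) (gT : finGroupType) (P : {group gT}) (n : nat).
Variables (phi : mx_representation F P n) (psi : gT -> F).
Hypothesis abs_irr : mx_absolutely_irreducible phi.
Hypothesis class2 : {in P &, forall x y, [~ x, y]%g \in 'Z(P)%g}.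
Hypothesis phiZ : {in 'Z(P)%g, forall z, phi z = (psi z)%:M}.
Hypothesis psi_inj : {in 'Z(P)%g, forall z, psi z = 1 -> z = 1%g}.
Variables (conj : {rmorphism F -> F}) (theta : 'M[F]_n -> 'M[F]_n).
Hypothesis thetaP : real_form conj theta.
Hypothesis phi_real : {in P, forall x, theta (phi x) = phi x}.

Let n_gt0 : (0 < n)%N.
Proof. by case/mx_abs_irrP: abs_irr. Qed.

Lemma real_scalar c M : theta M = M -> theta (c *: M) = c *: M -> M != 0 ->
  conj c = c.
Proof.
by move=> rM; rewrite (real_formZ thetaP) rM => rcM nzM; apply: scalemxI rcM.
Qed.

Definition real_intertwiner a T :=
  [/\ intertwines phi a T, T \in unitmx & theta T = T].

Lemma real_intertwinerM a b T U : a \in AutZ P ->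
  real_intertwiner a T -> real_intertwiner b U ->
  real_intertwiner (a * b)%g (T *m U).
Proof.
move=> aP [Ta uT rT] [Ub uU rU]; split; last by rewrite (real_formM thetaP) rT rU.
- by move=> x Px; rewrite mulmxA Ta // -!mulmxA Ub ?(AutZ_closed aP) // permM.
- by rewrite unitmx_mul uT.
Qed.

Lemma real_intertwinerZ a T c : real_intertwiner a T -> c != 0 -> conj c = c ->
  real_intertwiner a (c *: T).
Proof.
move=> [Ta uT rT] c0 rc; split; last by rewrite (real_formZ thetaP) rc rT.
- by move=> x Px; rewrite -scalemxAr Ta // scalemxAl.
- by rewrite unitmxZ ?unitfE.
Qed.

(** Since [phi] is real, [theta] preserves the space of intertwiners, so a
suitable multiple of any of them can be averaged. *)
Lemma exists_real_intertwiner a : a \in AutZ P -> exists T, real_intertwiner a T.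
Proof.
move=> aP; have [T0 T0a nzT0] := exists_intertwiner abs_irr class2 phiZ psi_inj aP.
have [c nzT] := real_form_nontrivial thetaP nzT0.
have Ta : intertwines phi a (c *: T0 + theta (c *: T0)).
  move=> x Px; rewrite mulmxDr mulmxDl.
  have cT0 : phi x *m (c *: T0) = c *: T0 *m phi (a x).
    by rewrite -scalemxAr T0a // scalemxAl.
  rewrite -[in X in _ + X = _](phi_real Px) -(real_formM thetaP) cT0.
  by rewrite (real_formM thetaP) (phi_real (AutZ_closed aP Px)).
exists (c *: T0 + theta (c *: T0)); split=> //.
  exact: (intertwiner_unit abs_irr Ta).
by rewrite (real_formD thetaP) (real_formK thetaP) addrC.
Qed.

Lemma real_intertwiner_unique a T U :
  real_intertwiner a T -> real_intertwiner a U ->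
  exists c, [/\ U = c *: T, c != 0 & conj c = c].
Proof.
move=> [Ta uT rT] [Ua uU rU].
have [c dU] := intertwiner_unique abs_irr Ta Ua uT; exists c; split=> //.
  by apply: contraTneq (unitmx_neq0 n_gt0 uU) => c0; rewrite dU c0 scale0r eqxx.
by apply: real_scalar (unitmx_neq0 n_gt0 uT); rewrite -?dU.
Qed.

Section FixedVectors.

Variable S : {group gT}.
Hypothesis sSP : S \subset P.
Hypothesis tiSZ : S :&: 'Z(P)%g = 1%g.

(** Up to the factor [#|S|], the projection onto the vectors fixed by [S]. *)
Definition repr_sum : 'M[F]_n := \sum_(s in S) phi s.
Local Notation E := repr_sum.

Let PS s : s \in S -> s \in P.
Proof. exact: (subsetP sSP). Qed.

Lemma mul_repr_sum s : s \in S -> phi s *m E = E.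
Proof.
move=> Ss; rewrite mulmx_sumr [RHS](reindex_inj (mulgI s)) /=.
apply: eq_big => [t|t St]; first by rewrite groupMl.
by rewrite repr_mxM ?PS.
Qed.

Lemma mul_sum_repr s : s \in S -> E *m phi s = E.
Proof.
move=> Ss; rewrite mulmx_suml [RHS](reindex_inj (mulIg s)) /=.
apply: eq_big => [t|t St]; first by rewrite groupMr.
by rewrite repr_mxM ?PS.
Qed.

(** Only the identity of [S] is central, so the trace is the degree of [phi]. *)
Lemma repr_sum_neq0 : E != 0.
Proof.
suff: \tr E != 0 by apply: contraNneq => ->; rewrite mxtrace0.
rewrite raddf_sum (bigD1 1%g) //= big1 => [|s /andP[Ss s1]].
  by rewrite addr0 repr_mx1 mxtrace1 Num.Theory.pnatr_eq0 -lt0n.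
apply: (mxtrace_off_center class2 phiZ psi_inj); first exact: PS.
apply: contra s1 => Zs; have: s \in S :&: 'Z(P)%g by rewrite inE Ss.
by rewrite tiSZ inE.
Qed.

Lemma repr_sum_real : theta E = E.
Proof.
have theta0 : theta 0 = 0.
  by rewrite -[X in theta X](scale0r 0) (real_formZ thetaP) rmorph0 scale0r.
rewrite (big_morph _ (real_formD thetaP) theta0).
by apply: eq_bigr => s /PS; apply: phi_real.
Qed.

Variable a : {perm gT}.
Hypothesis aP : a \in AutZ P.
Hypothesis aS : a @: S = S.
Hypothesis aC : {in 'C_P(S)%g, forall x, (a x * x^-1)%g \in S}.

Lemma intertwiner_sum_comm T : intertwines phi a T -> E *m T = T *m E.
Proof.
move=> Ta; rewrite mulmx_suml mulmx_sumr -{2}aS big_imset /=.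
  by apply: eq_bigr => s Ss; rewrite Ta ?PS.
by move=> x y _ _; apply: perm_inj.
Qed.

(** [T] is central in the corner algebra of the matrices [E *m M *m E], which is
the algebra of endomorphisms of the [S]-fixed vectors.  By absolute
irreducibility [M] may be taken to be some [phi x].  If [x] centralises [S],
then [a] changes [x] by an element of [S], which [E] absorbs; otherwise
[E *m phi x *m E] vanishes, being multiplied by a nontrivial scalar when [x] is
commuted past an element of [S]. *)
Lemma intertwiner_corner_comm T M : intertwines phi a T ->
  E *m M *m E *m T = T *m E *m M *m E.
Proof.
move=> Ta; have ET := intertwiner_sum_comm Ta.
have [_ [b_ spanP]] := mx_abs_irrP abs_irr; rewrite (spanP M).
suff: {in P, forall x, E *m phi x *m E *m T = T *m E *m phi x *m E}.
  (* [E] is generalised because it is itself a sum, not to be distributed. *)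
  move: E => E' cornerP; rewrite !(mulmx_sumr, mulmx_suml).
  apply: eq_bigr => x Px.
  by rewrite -!(scalemxAl, scalemxAr) cornerP.
move=> x Px.
have [/centP Cx | nCx] := boolP (x \in 'C(S)%g).
  have aSx : (a x * x^-1)%g \in S.
    by apply: aC; rewrite inE Px; apply/centP.
  have Eax : E *m phi (a x) = E *m phi x.
    rewrite -[a x](mulgKV x) repr_mxM ?(PS aSx) // mulmxA mul_sum_repr //.
  by rewrite -mulmxA ET mulmxA -(mulmxA E) Ta // !mulmxA ET
    -[T *m E *m phi (a x)]mulmxA Eax mulmxA.
have [s Ss nxs] : exists2 s, s \in S & (x * s != s * x)%g.
  have /existsP[s /andP[Ss nxs]] : [exists s in S, x * s != s * x]%g.
    apply: contraNT nCx => /existsPn xC; apply/centP=> s Ss.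
    by have := xC s; rewrite Ss negbK => /eqP.
  by exists s.
suff E0 : E *m phi x *m E = 0.
  by rewrite E0 mul0mx -2!(mulmxA T) E0 mulmx0.
have psi1 : psi [~ x, s]%g != 1.
  apply: contraNneq nxs => /(psi_inj (class2 Px (PS Ss))) xs1.
  by rewrite commgC xs1 mulg1.
have: E *m phi x *m E = psi [~ x, s]%g *: (E *m phi x *m E).
  rewrite -[X in _ *m X = _](mul_repr_sum Ss) mulmxA -(mulmxA E).
  rewrite (repr_commg class2 phiZ Px (PS Ss)).
  by rewrite -scalemxAr -scalemxAl mulmxA (mul_sum_repr Ss).
move/eqP; rewrite -subr_eq0 -{1}[E *m _ *m _]scale1r -scalerBl scaler_eq0.
by rewrite subr_eq0 eq_sym (negPf psi1) => /eqP.
Qed.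

(** An element central in the corner algebra is a scalar there.  Concretely, for
[M = delta_mx l j] both sides of [intertwiner_corner_comm] have rank at most
one, and comparing their entries in a column where [E] does not vanish gives
the scalar. *)
Lemma intertwiner_scalar_on_fixed T : intertwines phi a T ->
  exists c, T *m E = c *: E.
Proof.
move=> Ta.
have /existsP[j /existsP[k nzE]] : [exists j, exists k, E j k != 0].
  apply: contraNT repr_sum_neq0 => /existsPn E0; apply/eqP/matrixP=> j k.
  by rewrite mxE; have /existsPn/(_ k)/negbNE/eqP := E0 j.
exists ((E *m T) j k / E j k); apply/matrixP=> i l.
have /(congr1 (fun M : 'M_n => M i k)) := intertwiner_corner_comm (delta_mx l j) Ta.
rewrite -mulmxA !mulmx_deltaE => dT; rewrite [RHS]mxE.
by apply: (mulIf nzE); rewrite -dT mulrAC divfK // mulrC.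
Qed.

Lemma normalised_intertwiner : exists T, real_intertwiner a T /\ T *m E = E.
Proof.
have [T [Ta uT rT]] := exists_real_intertwiner aP.
have [c TE] := intertwiner_scalar_on_fixed Ta.
have nzc : c != 0.
  apply: contraNneq repr_sum_neq0 => c0.
  by rewrite -[E](mulKmx uT) TE c0 scale0r mulmx0.
have rc : conj c = c.
  apply: real_scalar repr_sum_real _ repr_sum_neq0.
  by rewrite -TE (real_formM thetaP) rT repr_sum_real.
exists (c^-1 *: T); split; last by rewrite -scalemxAl TE scalerA mulVf ?scale1r.
by apply: real_intertwinerZ; rewrite ?invr_eq0 ?fmorphV ?rc.
Qed.

End FixedVectors.

(** The normalised intertwiners are multiplicative on the Sylow subgroup [B].
Extending this choice along the right cosets of [B] makes the cocycle invariant
under [B], as the transfer requires. *)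
Theorem extend_to_automorphisms (p : nat) (A B : {group {perm gT}}) (S : {group gT}) :
  (p.-group P)%g -> A \subset AutZ P -> (p.-Sylow(A) B)%g ->
  S \subset P -> S :&: 'Z(P)%g = 1%g ->
  {in B, forall a : {perm gT}, a @: S = S} ->
  {in B & 'C_P(S)%g, forall (a : {perm gT}) x, (a x * x^-1)%g \in S} ->
  exists tau : {perm gT} -> 'M[F]_n,
    {in A, forall a, real_intertwiner a (tau a)} /\
    {in A &, {morph tau : a b / (a * b)%g >-> a *m b}}.
Proof.
move=> pP sAZ sylB sSP tiSZ BS BC.
have [sBA pB p'AB] := and3P sylB.
have AZ a : a \in A -> a \in AutZ P by apply: subsetP.
have BZ b : b \in B -> b \in AutZ P by move/(subsetP sBA)/AZ.
have /fin_all_exists[T0 T0P] :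
    forall a, exists T, a \in A -> real_intertwiner a T.
  move=> a; have [/AZ/exists_real_intertwiner[T aT]|] := boolP (a \in A).
    by exists T.
  by exists 0.
have /fin_all_exists[V VP] : forall b, exists T, b \in B ->
    real_intertwiner b T /\ T *m repr_sum S = repr_sum S.
  move=> b; have [Bb|] := boolP (b \in B); last by exists 0.
  have [||T bT] := normalised_intertwiner sSP tiSZ (BZ b Bb); first exact: BS.
    by move=> x Cx; apply: BC.
  by exists T.
have VM : {in B &, {morph V : a b / (a * b)%g >-> a *m b}}.
  move=> a b Ba Bb; have [Va aE] := VP a Ba; have [Vb bE] := VP b Bb.
  have [Vab abE] := VP _ (groupM Ba Bb).
  have [c [dV _ _]] := real_intertwiner_unique (real_intertwinerM (BZ a Ba) Va Vb) Vab.
  suff c1 : c = 1 by rewrite dV c1 scale1r.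
  apply: scalemxI (repr_sum_neq0 sSP tiSZ) _.
  by rewrite scale1r -[RHS]abE dV -scalemxAl -mulmxA bE aE.
pose r a := repr (B :* a)%g.
pose T (a : {perm gT}) := V (a * (r a)^-1)%g *m T0 (r a).
have rP a : a \in A -> r a \in A /\ (a * (r a)^-1)%g \in B.
  rewrite /r => Aa; case: repr_rcosetP => b Bb; rewrite invMg mulgA mulgV mul1g.
  by rewrite groupV Bb groupM // (subsetP sBA).
have TP a : a \in A -> real_intertwiner a (T a).
  move=> Aa; have [Ar Bar] := rP a Aa; have [Var _] := VP _ Bar.
  by rewrite -{1}[a](mulgKV (r a)); apply: real_intertwinerM (BZ _ Bar) Var (T0P _ Ar).
have T_coset : {in B & A, forall b a, T (b * a)%g = V b *m T a}.
  move=> b a Bb Aa; rewrite /T /r rcosetM rcoset_id // -mulgA -/(r a) VM ?mulmxA //.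
  by case: (rP a Aa).
have /fin_all_exists[c cP] : forall ab : {perm gT} * {perm gT}, exists c,
    ab.1 \in A -> ab.2 \in A ->
    T ab.1 *m T ab.2 = c *: T (ab.1 * ab.2)%g /\ conj c = c.
  move=> [a b] /=; have [Aa|_] := boolP (a \in A); last by exists 0.
  have [Ab|_] := boolP (b \in A); last by exists 0.
  have [k [dT _ rk]] := real_intertwiner_unique (TP _ (groupM Aa Ab))
    (real_intertwinerM (AZ a Aa) (TP a Aa) (TP b Ab)).
  by exists k.
have co : coprime n #|A : B|%g.
  apply: pnat_coprime p'AB; apply: pnat_dvd pP.
  by rewrite -(square_degree abs_irr class2 phiZ psi_inj) -mulnn -mulnA dvdn_mulr.
have T_unit : {in A, forall a, T a \in unitmx} by move=> a /TP[].
have T_proj : {in A &, forall a b, T a *m T b = c (a, b) *: T (a * b)%g}.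
  by move=> a b Aa Ab; case: (cP (a, b)).
have [g [g0 gM [u [v gE]]]] := linearise_proj_rep sBA n_gt0 T_unit T_proj T_coset co.
exists (fun a => g a *: T a); split=> [a Aa | a b Aa Ab]; last by rewrite gM.
apply: real_intertwinerZ (TP a Aa) (g0 a Aa) _.
rewrite gE // fmorph_div !rmorphXn /= -(real_form_det thetaP).
have [_ _ ->] := TP a Aa; congr (_ ^+ _ / _).
rewrite rmorph_prod; apply: eq_bigr => X /mem_repr_rcosets Ar.
by case: (cP (repr X, a)) => //=; apply: Ar.
Qed.

End Extension.

(** * Heisenberg groups *)

Section HeisenbergGroup.

Variables (gT : finGroupType) (p : nat) (P : {group gT}).
Hypotheses (p_pr : prime p) (heisP : heisenberg_group p P).

Lemma heisenberg_class2 : {in P &, forall x y, [~ x, y]%g \in 'Z(P)%g}.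
Proof.
case: heisP => _ abPZ _ _ x y Px Py.
by apply: (subsetP (der1_min (gFnorm _ _) abPZ)); apply: mem_commg.
Qed.

(** Commutators are central, of order dividing [p]; as [x ^+ p] has commutator
[[~ x, y] ^+ p] with [y], it is central, and [x ^+ (p * p)] is trivial. *)
Lemma heisenberg_pgroup : (p.-group P)%g.
Proof.
have [cardZ _ _ _] := heisP.
have expZ z : z \in 'Z(P)%g -> (z ^+ p = 1)%g.
  by rewrite -cardZ; apply: expg_cardG.
rewrite -pnat_exponent; apply: (@pnat_dvd _ (p ^ 2)); last by rewrite pnatX pnat_id.
apply/exponentP=> x Px; rewrite expnS expn1 expgM; apply: (expZ).
apply/centerP; split=> [|y Py]; first exact: groupX.
have /centerP[Pxy Cxy] := heisenberg_class2 Px Py.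
apply/commgP; rewrite commXg; last by apply/commute_sym/Cxy.
by rewrite expZ // heisenberg_class2.
Qed.

Lemma central_character_faithful (R : rcfType) (psi : gT -> complex R) :
  central_character P psi -> nontrivial_character P psi ->
  {in 'Z(P)%g, forall z, psi z = 1 -> z = 1%g}.
Proof.
case=> psi1 psiM [w Zw psiw] z Zz psiz; apply: contraNeq psiw => z1.
have [cardZ _ _ _] := heisP.
have sZz : 'Z(P)%g \subset <[z]>%g.
  apply: prime_meetG; first by rewrite cardZ.
  apply/trivgPn; exists z => //.
  by rewrite inE Zz cycle_id.
have psiX k : psi (z ^+ k)%g = 1.
  elim: k => [|k IHk]; first by rewrite expg0.
  by rewrite expgS psiM ?groupX // IHk psiz mulr1.
by have /cycleP[k ->] := subsetP sZz w Zw; rewrite psiX.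
Qed.

End HeisenbergGroup.

(** * The real forms attached to the three Frobenius-Schur types *)

Section RealForms.

Variable R : rcfType.
Local Notation C := (complex R).
Local Notation conj := (@conjc R).

(** Here [e *: J] is the inverse of [J], so this is conjugation followed by an
inner automorphism, with [e = 1] for a real structure and [e = -1] for a
quaternionic one. *)
Lemma conj_real_form n (J : 'M[C]_n) (e : C) :
  e * e = 1 -> conj e = e -> J *m J = e%:M -> map_mx conj J = J ->
  real_form (conj : {rmorphism C -> C})
    (fun M => e *: (J *m map_mx conj M *m J)).
Proof.
move=> ee re JJ rJ; split=> [M N|c M|M N|M|M|M nzM].
- by rewrite map_mxD mulmxDr mulmxDl scalerDr.
- by rewrite map_mxZ -scalemxAr -scalemxAl !scalerA mulrC.
- rewrite -scalemxAl -scalemxAr scalerA ee scale1r map_mxM !mulmxA.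
  by rewrite -(mulmxA _ J J) JJ mul_mx_scalar -!scalemxAl.
- rewrite detZ !det_mulmx det_map_mx mulrAC -det_mulmx JJ det_scalar mulrA.
  by rewrite -exprMn ee expr1n mul1r.
- rewrite map_mxZ /= re !map_mxM /= rJ -map_mx_comp.
  rewrite (_ : map_mx _ M = M); last by apply/matrixP=> i j; rewrite mxE /= conjcK.
  rewrite -scalemxAr -scalemxAl scalerA ee scale1r !mulmxA JJ.
  rewrite -(mulmxA _ J J) JJ.
  by rewrite mul_scalar_mx mul_mx_scalar scalerA ee scale1r.
pose theta M := e *: (J *m map_mx conj M *m J).
have thetaZ c : theta (c *: M) = conj c *: theta M.
  by rewrite /theta map_mxZ -scalemxAr -scalemxAl !scalerA mulrC.
(* If [M] averages to zero, then [theta M = - M], and the multiple ['i *: M] is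
   itself fixed because [theta] is antilinear. *)
suff [c nzc] : exists c, c *: M + theta (c *: M) != 0 by exists c.
clearbody theta.
have [M0|nz1] := eqVneq (M + theta M) 0; last by exists 1; rewrite scale1r.
exists 'i%C; rewrite thetaZ.
have -> : theta M = - M by apply/eqP; rewrite -addr_eq0 addrC M0.
rewrite scalerN -scalerBl scaler_eq0 (negPf nzM) orbF subcJ /=.
by rewrite !mulf_neq0 ?pnatr_eq0 // eq_complex /= ?oner_eq0 ?andbF.
Qed.

Definition fs_conj (t : fs_type) : {rmorphism C -> C} :=
  match t with FS_C => idfun | _ => conj end.

(** Right multiplication by [j] on [H^n] is entrywise conjugation followed by this
matrix. *)
Definition quat_structure n : 'M[C]_(n + n) := block_mx 0 (- 1%:M) 1%:M 0.

(** The scalar and the identity matrices in the case of type R display it in the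
form treated by [conj_real_form]. *)
Definition fs_theta (t : fs_type) n :
    'M[C]_(assoc_dim t n) -> 'M[C]_(assoc_dim t n) :=
  match t with
  | FS_R => fun M => 1 *: (1%:M *m map_mx conj M *m 1%:M)
  | FS_C => id
  | FS_H => fun M => -1 *: (quat_structure n *m map_mx conj M *m quat_structure n)
  end.

Lemma fs_real_form t n : real_form (fs_conj t) (@fs_theta t n).
Proof.
case: t => /=.
- by apply: conj_real_form; rewrite ?mulr1 ?rmorph1 ?mulmx1 ?map_mx1.
- split=> // M nzM; exists 1; rewrite scale1r -mulr2n -scaler_nat.
  by rewrite scaler_eq0 (negPf nzM) orbF Num.Theory.pnatr_eq0.
- apply: conj_real_form; rewrite ?mulrNN ?mulr1 //.
  - exact: (rmorphN1 conj).
  - rewrite /quat_structure mulmx_block !(mul0mx, mulmx0, add0r, addr0).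
    by rewrite mulmxN mulNmx !mulmx1 [RHS](@scalar_mx_block _ n n) raddfN.
  - by rewrite /quat_structure map_block_mx map_mxN !map_mx0 !map_mx1.
Qed.

Lemma quat_structure_conj n (a b c d : 'M[C]_n) :
  -1 *: (quat_structure n *m block_mx a b c d *m quat_structure n) =
  block_mx d (- c) (- b) a.
Proof.
rewrite /quat_structure mulmx_block !mul0mx !add0r !mulNmx !mul1mx !addr0.
rewrite mulmx_block !mulmx0 !add0r !addr0 !mulmxN !mulmx1.
by rewrite scale_block_mx !scaleN1r !opprK.
Qed.

Lemma quat_thetaE n a b c d : @fs_theta FS_H n (block_mx a b c d) =
  block_mx (map_mx conj d) (- map_mx conj c) (- map_mx conj b) (map_mx conj a).
Proof.
by rewrite /= map_block_mx quat_structure_conj.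
Qed.

Lemma assoc_mx_real t m (D : 'M[fs_ring R t]_m) :
  fs_theta (assoc_mx D) = assoc_mx D.
Proof.
case: t D => //= D.
- rewrite scale1r mul1mx mulmx1; apply/matrixP=> i j; rewrite !mxE.
  exact: conjc_real.
- rewrite [LHS](@quat_thetaE m) map_mxN -!map_mx_comp /complex_of_quat_mx.
  by congr block_mx; rewrite ?opprK; apply/matrixP=> i j; rewrite !mxE /= ?opprK.
Qed.

Lemma assoc_mx_onto t m (M : 'M[C]_(assoc_dim t m)) :
  fs_theta M = M -> exists D : 'M[fs_ring R t]_m, assoc_mx D = M.
Proof.
case: t M => /= M.
- rewrite scale1r mul1mx mulmx1 => rM; exists (map_mx (@complex.Re R) M).
  apply/matrixP=> i j; rewrite !mxE.
  move/matrixP/(_ i j): rM; rewrite mxE.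
  case: (M i j) => x y /= [ny]; congr (_ +i* _)%C; apply/esym/eqP.
  by rewrite -[_ == 0](mulrn_eq0 _ 2) //= mulr2n -{1}ny addNr.
- by exists M.
rewrite -[M]submxK [X in X = _ -> _](@quat_thetaE m).
move: (ulsubmx M) (ursubmx M) (dlsubmx M) (drsubmx M) => a b c d.
case/eq_block_mx=> _ cb _ ad.
exists (\matrix_(i, j) Quat (complex.Re (a i j)) (complex.Im (a i j))
                            (complex.Re (c i j)) (- complex.Im (c i j))).
rewrite /complex_of_quat_mx -ad -cb; congr block_mx.
all: apply/matrixP=> i j; rewrite !mxE /quat_fst /quat_snd /= ?opprK.
all: by case: (a i j); case: (c i j).
Qed.

Lemma assoc_mx_inj t m : injective (@assoc_mx R t m).
Proof.
case: t => /= D D'.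
- exact: map_mx_inj.
- by [].
case/eq_block_mx=> /matrixP dfst _ /matrixP dsnd _; apply/matrixP=> i j.
move: (dfst i j) (dsnd i j); rewrite !mxE => E1 E2.
by rewrite (quat_decomp (D i j)) E1 E2 -quat_decomp.
Qed.

Lemma assoc_mxM t m (D D' : 'M[fs_ring R t]_m) :
  assoc_mx (D *m D') = assoc_mx D *m assoc_mx D'.
Proof.
case: t D D' => D D' //=; first exact: map_mxM.
exact: complex_of_quat_mxM.
Qed.

Lemma assoc_mx1 t m : assoc_mx (1%:M : 'M[fs_ring R t]_m) = 1%:M.
Proof.
by case: t => //=; [exact: map_mx1 | exact: complex_of_quat_mx1].
Qed.

End RealForms.

(** * Representations of the semidirect product *)

Section SemidirectRep.

Variables (gT : finGroupType) (P : {group gT}) (A : {group {perm gT}}).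
Hypothesis sA : A \subset AutZ P.

(** An element of the semidirect product is a pair [(a, x)] standing for the
product of [a] and [x] in this order, hence acts by [U a *m rho x]. *)
Lemma extends_of_intertwiners (D : nzRingType) m (rho : matrix_rep D P m)
    (U : {perm gT} -> 'M[D]_m) :
  U 1%g = 1%:M -> {in A &, {morph U : a b / (a * b)%g >-> a *m b}} ->
  {in P & A, forall x a, rho x *m U a = U a *m rho (a x)} ->
  extends_to_semidirect sA rho.
Proof.
move=> U1 UM UP; have [rho1 rhoM] := rep_mxP rho.
pose rho' (u : semidirect sA) := U (pair_of_sd u).1 *m rho (pair_of_sd u).2.
have actE x a : AutZ_gact sA x a = a x by [].
have rho'P : rho' 1%g = 1%:M /\
    {in [set: semidirect sA]%G &, {morph rho' : u v / (u * v)%g >-> u *m v}}.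
  split=> [|u v _ _]; first by rewrite /rho' /= U1 rho1 mulmx1.
  case: u v => [[a x] /= ax] [[b y] /= by_].
  have /setXP[/= Aa Px] := ax; have /setXP[/= Ab Py] := by_.
  rewrite /rho' /= actE // UM // rhoM ?(AutZ_closed (subsetP sA b Ab)) //.
  by rewrite !mulmxA; congr (_ *m _); rewrite -!mulmxA UP.
exists (MatrixRep rho'P) => x Px.
rewrite /= /rho' /in_semidirect /sdpair1 val_insubd inE /= group1 Px /=.
by rewrite U1 mul1mx.
Qed.

End SemidirectRep.

(** * Splittings and parabolic subgroups *)

(** Elements of [P] commuting with [S] commute with the whole preimage of [W],
which is generated by [S] and the centre; so they lie in [perp_preim W]. *)
Lemma parabolic_fixes_splitting (gT : finGroupType) (P : {group gT})
    (W : {group coset_of 'Z(P)%g}) (S : {group gT}) (a : {perm gT}) :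
  splitting W S -> a \in parabolic W S ->
  [/\ a \in AutZ P, a @: S = S
    & {in 'C_P(S)%g, forall x, (a x * x^-1)%g \in S}].
Proof.
move=> [sSP isoS]; rewrite inE => /and3P[aP /eqP aS /forall_inP aC]; split=> // x.
case/setIP=> Px /centP Cx; apply: aC; rewrite inE Px; apply/forall_inP=> y Py.
apply/implyP=> Wy; rewrite omega_eq1; apply/eqP.
have nZ z : z \in P -> z \in 'N('Z(P)%g) by apply: (subsetP (gFnorm _ _)).
have [s Ss dy] : exists2 s, s \in S & coset 'Z(P)%g y = coset 'Z(P)%g s.
  have [y1|y1] := eqVneq (coset 'Z(P)%g y) 1%g; first by exists 1%g; rewrite ?morph1.
  have: coset 'Z(P)%g y \in W^#%g by rewrite !inE y1.
  by rewrite -(eqP isoS) => /imsetP[s /setD1P[_ Ss] ->]; exists s.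
have Ps := subsetP sSP s Ss.
have /rcosetP[z /centerP[_ Cz] ->] : y \in ('Z(P) :* s)%g.
  by rewrite -val_coset ?nZ // -dy val_coset ?nZ // rcoset_refl.
by rewrite mulgA -Cz // -!mulgA Cx.
Qed.

Lemma splitting_cap_center (gT : finGroupType) (P : {group gT})
    (W : {group coset_of 'Z(P)%g}) (S : {group gT}) :
  splitting W S -> S :&: 'Z(P)%g = 1%g.
Proof.
move=> [sSP isoS]; apply/trivgP/subsetP=> s /setIP[Ss Zs].
rewrite inE; apply: contraT => s1.
have: coset 'Z(P)%g s \in W^#%g by rewrite -(eqP isoS) imset_f // !inE s1.
by rewrite coset_id // !inE eqxx.
Qed.

(** * Extension of Heisenberg representations *)

Theorem lemma3p4p9 :
  forall (R : realType) (p : nat) (gT : finGroupType) (P : {group gT}),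
  prime p -> heisenberg_group p P ->
  forall psi : gT -> complex R,
  central_character P psi -> nontrivial_character P psi ->
  forall (n : nat) (phi : mx_representation (complex R) P n),
  heisenberg_repr psi phi ->
  forall t : fs_type, has_fs_type phi t ->
  forall (A : {group {perm gT}}) (sA : A \subset AutZ P),
  (exists (Ap : {group {perm gT}}) (Vp : {group coset_of 'Z(P)%g})
          (S : {group gT}),
     [/\ (p.-Sylow(A) Ap)%g, isotropic p Vp, splitting Vp S
       & Ap \subset parabolic Vp S]) ->
  forall (m : nat) (rho : matrix_rep (fs_ring R t) P m),
  heisenberg_Rrep phi rho ->
  extends_to_semidirect sA rho.
Proof.
move=> R p gT P p_pr heisP psi psi_char psi_nt n phi [irr_phi phiZ] t _ A sA.
case=> Ap [W [S [sylAp _ splitS sApS]]] m rho [_ sim_rho].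
pose chi := assoc_repr rho.
have abs_chi : mx_absolutely_irreducible chi.
  apply: group_closure_closed_field.
  exact: mx_rsim_irr (mx_rsim_sym sim_rho) irr_phi.
have chiZ : {in 'Z(P)%g, forall z, chi z = (psi z)%:M}.
  move=> z Zz; have [B _ freeB chiB] := sim_rho.
  apply: (row_free_inj freeB); have Pz := subsetP (center_sub P) z Zz.
  by rewrite chiB // phiZ // mul_mx_scalar mul_scalar_mx.
have chi_real : {in P, forall x, fs_theta (chi x) = chi x}.
  by move=> x _; apply: assoc_mx_real.
have class2 := heisenberg_class2 heisP.
have psi_inj := central_character_faithful p_pr heisP psi_char psi_nt.
have parab b := fun Bb : b \in Ap => parabolic_fixes_splitting splitS (subsetP sApS b Bb).
have [||tau [tauP tauM]] := extend_to_automorphisms abs_chi class2 chiZ psi_inj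
    (fs_real_form R t m) chi_real (heisenberg_pgroup p_pr heisP) sA sylAp
    (proj1 splitS) (splitting_cap_center splitS).
- by move=> b /parab[].
- by move=> b x /parab[_ _ bC]; apply: bC.
have /fin_all_exists[U UE] : forall a, exists D : 'M[fs_ring R t]_m,
    a \in A -> assoc_mx D = tau a.
  move=> a; have [/tauP[_ _ /assoc_mx_onto[D dD]]|_] := boolP (a \in A).
    by exists D.
  by exists 0.
apply: (@extends_of_intertwiners _ _ _ sA _ _ _ U).
- apply: assoc_mx_inj; rewrite assoc_mx1 UE ?group1 //.
  have [_ tau1 _] := tauP _ (group1 A).
  by rewrite -[LHS](mulmxK tau1) -tauM ?group1 // mulg1 mulmxV.
- move=> a b Aa Ab; apply: assoc_mx_inj.
  by rewrite assoc_mxM !UE ?groupM // tauM.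
move=> x a Px Aa; apply: assoc_mx_inj; rewrite !assoc_mxM UE //.
by have [tau_a _ _] := tauP a Aa; apply: tau_a.
Qed.
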